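(* Let $\mathcal C\subset\mathbb R^n$ be nonempty, compact and convex; let $f:\mathbb R^n\to\mathbb R$ be continuously differentiable on an open set containing $\mathcal C$ with $\nabla f$ Lipschitz-continuous on $\mathcal C$; let $T:\mathbb R^n\to\mathbb R^m$ be linear; let $\mathcal D\subset\mathbb R^m$ be nonempty, closed and convex with $\mathcal D\cap T(\mathcal C)\ne\varnothing$; and let $g=\iota_{\mathcal D}$. Suppose $(u_j)_j\subset\mathcal C$ and $(\alpha_j)_j\subset\,]0,+\infty[$ satisfy $\alpha_j\to0$, $u_j\to\bar u$, and $\mathrm{gap}^{\alpha_j}(u_j)\to0$. Then, with $\widetilde{\mathcal C}:=\mathcal C\cap T^{-1}(\mathcal D)$, one has $\bar u\in\widetilde{\mathcal C}$ and $\widetilde{\mathrm{gap}}(\bar u)=0$; equivalently, $0\in\nabla f(\bar u)+N_{\widetilde{\mathcal C}}(\bar u)$. If moreover $\operatorname{ri}(\mathcal D)\cap\operatorname{ri}(T(\mathcal C))\neq\varnothing$, this can be rewritten as $$0\in\nabla f(\bar u)+N_{\mathcal C}(\bar u)+T^*N_{\mathcal D}(T\bar u).$$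
   Context: $\iota_{\mathcal D}$ is $0$ on $\mathcal D$ and $+\infty$ elsewhere. For $\beta>0$, $g^\beta(y)=\min_u\{g(u)+\frac1{2\beta}\|u-y\|_2^2\}$ is the Moreau envelope; here $g^\beta=\frac1{2\beta}\mathrm{dist}_{\mathcal D}^2$ and $\nabla g^\beta(y)=\beta^{-1}(y-\mathrm{proj}_{\mathcal D}(y))$. Smoothed Frank-Wolfe gap: for $x\in\mathcal C$, $\mathrm{gap}^\beta(x):=\max_{s\in\mathcal C}\langle\nabla f(x)+T^*\nabla g^\beta(Tx),x-s\rangle$. Signed nonsmooth Frank-Wolfe gap: $\widetilde{\mathrm{gap}}(x):=\max_{s\in\widetilde{\mathcal C}}\langle\nabla f(x),x-s\rangle$. $N_S(x)=\{v:\langle v,s-x\rangle\le0\ \forall s\in S\}$ for $x\in S$ (and $\varnothing$ for $x\notin S$) is the normal cone; $\operatorname{ri}$ is the relative interior. *)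

(* Defs.v *)
From mathcomp Require Import all_boot all_order all_algebra.
From mathcomp Require Import all_classical all_reals all_analysis.

Set Implicit Arguments.
Unset Strict Implicit.
Unset Printing Implicit Defensive.

Import Order.TTheory GRing.Theory Num.Theory.
Import numFieldNormedType.Exports.

Local Open Scope classical_set_scope.
Local Open Scope ring_scope.

(* R^n is 'rV[R]_n. The library's norm `|x| on it is the sup norm: it gives the
   usual topology and differentials, but Euclidean quantities use enorm. *)

Definition dot (R : realType) (n : nat) (x y : 'rV[R]_n) : R :=
  \sum_(i < n) x 0 i * y 0 i.

Definition enorm (R : realType) (n : nat) (x : 'rV[R]_n) : R :=
  Num.sqrt (dot x x).

Definition grad (R : realType) (n : nat) (f : 'rV[R]_n -> R) (x : 'rV[R]_n)
    : 'rV[R]_n :=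
  \row_(i < n) 'D_(delta_mx 0 i) f x.

Definition adjoint (R : realType) (n m : nat)
    (T : {linear 'rV[R]_n -> 'rV[R]_m}) (y : 'rV[R]_m) : 'rV[R]_n :=
  y *m (lin1_mx T)^T.

Lemma dot_adjoint (R : realType) (n m : nat)
    (T : {linear 'rV[R]_n -> 'rV[R]_m}) (x : 'rV[R]_n) (y : 'rV[R]_m) :
  dot (T x) y = dot x (adjoint T y).
Proof.
have dotE k (a b : 'rV[R]_k) : dot a b = (a *m b^T) 0 0.
  by rewrite mxE; apply: eq_bigr => i _; rewrite !mxE.
by rewrite !dotE /adjoint trmx_mul trmxK mulmxA mul_rV_lin1.
Qed.

Definition continuously_differentiable_on (R : realType) (n : nat)
    (U : set 'rV[R]_n) (f : 'rV[R]_n -> R) : Prop :=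
  (forall x, U x -> differentiable f x) /\ {within U, continuous (grad f)}.

Definition lipschitz_grad_on (R : realType) (n : nat)
    (C : set 'rV[R]_n) (f : 'rV[R]_n -> R) : Prop :=
  exists L : R, forall x y, C x -> C y ->
    enorm (grad f x - grad f y) <= L * enorm (x - y).

Definition indicator (R : realType) (m : nat) (D : set 'rV[R]_m)
    (y : 'rV[R]_m) : \bar R :=
  if y \in D then 0%E else +oo%E.

Definition moreau (R : realType) (m : nat) (g : 'rV[R]_m -> \bar R) (beta : R)
    (y : 'rV[R]_m) : \bar R :=
  ereal_inf [set (g u + ((2 * beta)^-1 * enorm (u - y) ^+ 2)%:E)%E | u in setT].

(* Extended-real suprema in the two gaps: each is a maximum when the feasible
   set is nonempty and compact, and -oo (not a junk 0) when it is empty. *)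

Definition smoothed_gap (R : realType) (n m : nat) (f : 'rV[R]_n -> R)
    (T : {linear 'rV[R]_n -> 'rV[R]_m}) (g : 'rV[R]_m -> \bar R)
    (C : set 'rV[R]_n) (beta : R) (x : 'rV[R]_n) : \bar R :=
  ereal_sup [set (dot (grad f x +
      adjoint T (grad (fun y => fine (moreau g beta y)) (T x))) (x - s))%:E
    | s in C].

Definition signed_gap (R : realType) (n : nat) (f : 'rV[R]_n -> R)
    (S : set 'rV[R]_n) (x : 'rV[R]_n) : \bar R :=
  ereal_sup [set (dot (grad f x) (x - s))%:E | s in S].

Definition normal_cone (R : realType) (n : nat) (S : set 'rV[R]_n)
    (x : 'rV[R]_n) : set 'rV[R]_n :=
  [set v | S x /\ forall s, S s -> dot v (s - x) <= 0].

Definition affine_set (R : realType) (n : nat) (A : set 'rV[R]_n) : Prop :=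
  forall (x y : 'rV[R]_n) (t : R), A x -> A y -> A ((1 - t) *: x + t *: y).

Definition affine_hull (R : realType) (n : nat) (S : set 'rV[R]_n)
    : set 'rV[R]_n :=
  smallest (@affine_set R n) S.

Definition relative_interior (R : realType) (n : nat) (S : set 'rV[R]_n)
    : set 'rV[R]_n :=
  [set x | S x /\ \forall y \near x, affine_hull S y -> S y].

(* Main.v *)
Require Import Defs.
From mathcomp Require Import all_boot all_order all_algebra.
From mathcomp Require Import all_classical all_reals all_analysis.
From mathcomp Require Import ring lra.

Import Order.TTheory GRing.Theory Num.Theory.
Import numFieldNormedType.Exports.

Local Open Scope classical_set_scope.
Local Open Scope ring_scope.

(* With r_j = T u_j - proj_D(T u_j) and w_j = r_j / alpha_j, the smoothed gradient is
   grad f(u_j) + T^* w_j, so bounding the gap gives, for s in C and d in D,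
     <grad f(u_j), u_j - s> - gap_j <= <w_j, T s - d>.
   For s in C with T s in D the term <w_j, T u_j - T s> is at least |r_j|^2 / alpha_j,
   which forces r_j -> 0 and, in the limit, <grad f(ubar), ubar - s> <= 0.
   When the relative interiors meet, M = T(C) - D contains a negative multiple of
   each of its points, so the lower bound above bounds <w_j, z> on both sides for
   every z in M.  Hence the components of w_j along span M have a cluster point w,
   and <grad f(ubar), ubar - s> <= <w, T s - d> makes w a multiplier in N_D(T ubar);
   no separation theorem is needed. *)

(** * Euclidean inner product on row vectors *)

Lemma dotC {R : realType} {n : nat} (x y : 'rV[R]_n) : dot x y = dot y x.
Proof. by apply: eq_bigr => i _; rewrite mulrC. Qed.

Lemma dotDl {R : realType} {n : nat} (x y z : 'rV[R]_n) :
  dot (x + y) z = dot x z + dot y z.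
Proof. by rewrite -big_split; apply: eq_bigr => i _; rewrite mxE mulrDl. Qed.

Lemma dotZl {R : realType} {n : nat} (a : R) (x z : 'rV[R]_n) :
  dot (a *: x) z = a * dot x z.
Proof. by rewrite mulr_sumr; apply: eq_bigr => i _; rewrite mxE mulrA. Qed.

Lemma dotNl {R : realType} {n : nat} (x z : 'rV[R]_n) : dot (- x) z = - dot x z.
Proof. by rewrite -scaleN1r dotZl mulN1r. Qed.

Lemma dotDr {R : realType} {n : nat} (x y z : 'rV[R]_n) :
  dot z (x + y) = dot z x + dot z y.
Proof. by rewrite dotC dotDl !(dotC z). Qed.

Lemma dotZr {R : realType} {n : nat} (a : R) (x z : 'rV[R]_n) :
  dot z (a *: x) = a * dot z x.
Proof. by rewrite dotC dotZl (dotC z). Qed.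

Lemma dotNr {R : realType} {n : nat} (x z : 'rV[R]_n) : dot z (- x) = - dot z x.
Proof. by rewrite dotC dotNl (dotC z). Qed.

Lemma dot0l {R : realType} {n : nat} (x : 'rV[R]_n) : dot 0 x = 0.
Proof. by rewrite -(scale0r 0) dotZl mul0r. Qed.

Lemma dot0r {R : realType} {n : nat} (x : 'rV[R]_n) : dot x 0 = 0.
Proof. by rewrite dotC dot0l. Qed.

Definition dotE := (@dotDl, @dotDr, @dotNl, @dotNr, @dotZl, @dotZr).

Lemma dotBB {R : realType} {n : nat} (x y : 'rV[R]_n) :
  dot (x - y) (x - y) = dot x x - 2 * dot x y + dot y y.
Proof. by rewrite !dotE (dotC y x); ring. Qed.

Lemma dot_ge0 {R : realType} {n : nat} (x : 'rV[R]_n) : 0 <= dot x x.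
Proof. by apply: sumr_ge0 => i _; rewrite -expr2 sqr_ge0. Qed.

Lemma dot_eq0 {R : realType} {n : nat} (x : 'rV[R]_n) : dot x x = 0 -> x = 0.
Proof.
move=> x0; apply/rowP => i; rewrite mxE.
have /psumr_eq0P := x0; move=> /(_ _ i isT) h.
by apply/eqP; rewrite -sqrf_eq0 expr2 h// => j _; rewrite -expr2 sqr_ge0.
Qed.

Lemma enorm_sqr {R : realType} {n : nat} (x : 'rV[R]_n) :
  enorm x ^+ 2 = dot x x.
Proof. by rewrite sqr_sqrtr// dot_ge0. Qed.

Lemma dot_mulmx {R : realType} {n : nat} (x y : 'rV[R]_n) :
  dot x y = (x *m y^T) 0 0.
Proof. by rewrite mxE; apply: eq_bigr => i _; rewrite mxE. Qed.

Lemma dot_delta {R : realType} {n : nat} (x : 'rV[R]_n) (i : 'I_n) :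
  dot x (delta_mx 0 i) = x 0 i.
Proof.
rewrite /dot (bigD1 i)//= mxE !eqxx mulr1 big1 ?addr0// => j ji.
by rewrite mxE (negbTE ji) andbF mulr0.
Qed.

Lemma coord_le_dot {R : realType} {n : nat} (x : 'rV[R]_n) (i : 'I_n) :
  x 0 i ^+ 2 <= dot x x.
Proof.
rewrite /dot (bigD1 i)//= -expr2 lerDl.
by apply: sumr_ge0 => j _; rewrite -expr2 sqr_ge0.
Qed.

Lemma cvg_dot {R : realType} {n : nat} {I : Type} {F : set_system I}
    {FF : Filter F} {a b : I -> 'rV[R]_n} {x y : 'rV[R]_n} :
  a j @[j --> F] --> x -> b j @[j --> F] --> y ->
  dot (a j) (b j) @[j --> F] --> dot x y.
Proof.
move=> ax b_y; rewrite /dot; apply: cvg_big => [|i _]; first exact: add_continuous.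
apply: cvgM.
  exact: (cvg_comp a (fun M : 'rV[R]_n => M 0 i) ax
    (@coord_continuous _ _ _ 0 i x)).
exact: (cvg_comp b (fun M : 'rV[R]_n => M 0 i) b_y
  (@coord_continuous _ _ _ 0 i y)).
Qed.

(** * Projection onto a closed convex set and the gradient of its Moreau envelope *)

Lemma projection_exists {R : realType} {m : nat} (D : set 'rV[R]_m)
    (D_nonempty : D !=set0) (D_closed : closed D) (D_convex : convex_set D)
    (y : 'rV[R]_m) :
  exists2 p, D p & forall d, D d -> dot (y - p) (d - p) <= 0.
Proof.
have [d0 Dd0] := D_nonempty.
pose r := enorm (d0 - y).
have r0 : 0 <= r by exact: sqrtr_ge0.
have sqr x : x ^+ 2 <= r ^+ 2 -> - r <= x <= r by move=> ?; nra.
(* Every point at least as close to [y] as [d0] lies in this compact box, so a minimizer over its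
   intersection with [D] is a minimizer over all of [D]. *)
pose box := [set d : 'rV[R]_m | forall i,
  `[y 0 i - r, y 0 i + r]%classic (d ord0 i)].
have box_compact : compact box.
  apply: (@rV_compact _ _ (fun i => `[y 0 i - r, y 0 i + r]%classic)) => i.
  exact: segment_compact.
have boxP d : dot (d - y) (d - y) <= r ^+ 2 -> box d.
  move=> dr i /=; rewrite in_itv/=.
  have /sqr := le_trans (coord_le_dot (d - y) i) dr.
  by rewrite !mxE; lra.
have [p] : exists2 p, p \in box `&` D & forall d, d \in box `&` D ->
    dot (p - y) (p - y) <= dot (d - y) (d - y).
  apply: (@EVT_min_rV _ _ (fun d => dot (d - y) (d - y))).
  - by exists d0; split=> //; apply: boxP; rewrite -enorm_sqr.
  - exact: compact_closedI.
  - apply: continuous_subspaceT => d.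
    have dc : (fun z : 'rV[R]_m => z - y) @ nbhs d --> d - y.
      by apply: cvgB; [exact: cvg_id|exact: cvg_cst].
    exact: (cvg_dot dc dc).
rewrite inE => -[bp Dp] pmin0.
have pmin d : D d -> dot (p - y) (p - y) <= dot (d - y) (d - y).
  move=> Dd; have [dr|/ltW rd] := leP (dot (d - y) (d - y)) (r ^+ 2).
    by apply: pmin0; rewrite inE; split=> //; exact: boxP.
  apply: le_trans rd; rewrite enorm_sqr; apply: pmin0.
  by rewrite inE; split=> //; apply: boxP; rewrite -enorm_sqr.
exists p => // d Dd; rewrite leNgt; apply/negP => pos.
set a := dot (y - p) (d - p) in pos; set b := dot (d - p) (d - p).
have b0 : 0 <= b by exact: dot_ge0.
have key t : 0 <= t <= 1 -> 2 * t * a <= t ^+ 2 * b.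
  move=> t01; have Dt : D (t *: d + (1 - t) *: p).
    have /andP[t0 t1] := t01.
    by have := D_convex d p (Itv01 t0 t1); rewrite !inE; exact.
  have := pmin _ Dt.
  have -> : t *: d + (1 - t) *: p - y = t *: (d - p) + (p - y).
    by apply/rowP => i; rewrite !mxE; ring.
  rewrite /a /b !dotE (dotC d p) (dotC y p) (dotC y d); nra.
(* This [t] lies in [[0, 1]] even when [b = 0]; [key] then reads [a ^+ 2 * (2 * a + b) <= 0],
   contradicting [0 < a]. *)
have := key (a / (a + b)); have ab0 : 0 < a + b by lra.
have t01 : 0 <= a / (a + b) <= 1.
  apply/andP; split; first exact: divr_ge0 (ltW pos) (ltW ab0).
  by rewrite ler_pdivrMr// mul1r lerDl.
move=> /(_ t01).
have -> : 2 * (a / (a + b)) * a = 2 * a ^+ 2 / (a + b).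
  by field; rewrite gt_eqF.
have -> : (a / (a + b)) ^+ 2 * b = (a ^+ 2 * b / (a + b)) / (a + b).
  by field; rewrite gt_eqF.
rewrite ler_pM2r ?invr_gt0// ler_pdivlMr//.
have : 0 < a ^+ 2 * (2 * a + b) by rewrite mulr_gt0 ?exprn_gt0//; lra.
lra.
Qed.

(** Along each basis vector the difference quotient is within a multiple of [|h|] of the coordinate
    of [G], so no differentiability has to be assumed. *)
Lemma grad_quadratic_bound {R : realType} {n : nat} (F : 'rV[R]_n -> R)
    (y G : 'rV[R]_n) (K : R)
    (FG : forall z, `|F z - F y - dot G (z - y)| <= K * dot (z - y) (z - y)) :
  grad F y = G.
Proof.
apply/rowP => i; rewrite mxE -dot_delta.
set v := delta_mx 0 i : 'rV[R]_n.
apply: cvg_lim => //; apply/cvgrPdist_le => e e0.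
have K0 : 0 <= K * dot v v.
  by have := FG (v + y); rewrite addrK; apply: le_trans; exact: normr_ge0.
near=> h.
have h0 : h != 0 by near: h; exact: nbhs_dnbhs_neq.
have -> : dot G v - h^-1 *: ((F \o shift y) (h *: v) - F y) =
    - h^-1 * (F (h *: v + y) - F y - dot G (h *: v + y - y)).
  by rewrite addrK dotZr /= /GRing.scale /=; field.
rewrite normrM normrN normfV ler_pdivrMl ?normr_gt0//.
apply: le_trans (FG _) _.
rewrite addrK !(dotZl, dotZr).
have -> : K * (h * (h * dot v v)) = `|h| * (`|h| * (K * dot v v)).
  by rewrite [RHS]mulrA -normrM -expr2 ger0_norm ?sqr_ge0//; ring.
rewrite ler_wpM2l//.
(* The [+ 1] keeps the denominator positive when [K * dot v v] vanishes. *)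
have he : `|h| <= e / (K * dot v v + 1).
  near: h; apply: dnbhs0_le; rewrite divr_gt0//; lra.
apply: (le_trans (ler_wpM2r K0 he)).
rewrite mulrAC ler_pdivrMr; last lra.
nra.
Unshelve. all: by end_near. Qed.

(** The variational inequality gives |d - y|^2 >= |p - y|^2 + |d - p|^2 on [D], so [p] attains the
    infimum; off [D] the objective is [+oo]. *)
Lemma moreau_indicatorE {R : realType} {m : nat} (D : set 'rV[R]_m) (beta : R)
    (beta0 : 0 < beta) (y p : 'rV[R]_m) (Dp : D p)
    (pP : forall d, D d -> dot (y - p) (d - p) <= 0) :
  fine (moreau (indicator D) beta y) = (2 * beta)^-1 * dot (y - p) (y - p).
Proof.
suff -> : moreau (indicator D) beta y =
  ((2 * beta)^-1 * dot (y - p) (y - p))%:E by [].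
apply/eqP; rewrite eq_le; apply/andP; split.
  apply: ge_ereal_inf; exists ((2 * beta)^-1 * dot (y - p) (y - p))%:E => //.
  exists p => //; rewrite /indicator mem_set// add0e enorm_sqr.
  by rewrite -(opprB y p) dotNl dotNr opprK.
apply: le_ereal_inf_tmp => _ [d _ <-]; rewrite /indicator.
have [|_] := boolP (d \in D); last by rewrite addye// leey.
rewrite inE => Dd; rewrite add0e lee_fin enorm_sqr ler_wpM2l//.
  by rewrite invr_ge0; lra.
have := pP d Dd; have := dot_ge0 (d - p).
rewrite !dotE (dotC d p) (dotC y p) (dotC y d); lra.
Qed.

(** With [q] the projection of [z], the first-order remainder of the squared distance lies between 0
    (inequality at [p], tested on [q]) and |z - y|^2 (inequality at [q], tested on [p]). *)
Lemma grad_moreau_indicator {R : realType} {m : nat} (D : set 'rV[R]_m)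
    (D_nonempty : D !=set0) (D_closed : closed D) (D_convex : convex_set D)
    (beta : R) (beta0 : 0 < beta) (y p : 'rV[R]_m) (Dp : D p)
    (pP : forall d, D d -> dot (y - p) (d - p) <= 0) :
  grad (fun z => fine (moreau (indicator D) beta z)) y = beta^-1 *: (y - p).
Proof.
apply: (@grad_quadratic_bound _ _ _ _ _ (2 * beta)^-1) => z.
have [q Dq qP] := projection_exists D D_nonempty D_closed D_convex z.
rewrite (moreau_indicatorE _ _ beta0 _ _ Dp pP).
rewrite (moreau_indicatorE _ _ beta0 _ _ Dq qP).
have -> : beta^-1 = 2 * (2 * beta)^-1 by field; lra.
rewrite dotZl.
have := pP q Dq; have := qP p Dp.
have := dot_ge0 (z - q - (y - p)); have := dot_ge0 (q - p).
set k := (2 * beta)^-1; have k0 : 0 < k by rewrite invr_gt0; lra.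
move=> h1 h2 h3 h4.
have -> : k * dot (z - q) (z - q) - k * dot (y - p) (y - p) -
    2 * k * dot (y - p) (z - y) =
    k * (dot (z - q) (z - q) - dot (y - p) (y - p) - 2 * dot (y - p) (z - y)).
  ring.
rewrite normrM (ger0_norm (ltW k0)) ler_pM2l//.
move: h1 h2 h3 h4; rewrite !dotE.
rewrite (dotC z y) (dotC z p) (dotC z q) (dotC q y) (dotC q p) (dotC p y).
by move=> *; rewrite ler_norml; apply/andP; split; lra.
Qed.

(** * Prolongation at relative interior points and cluster points of pairings *)

Lemma relative_interior_extend {R : realType} {n : nat} (S : set 'rV[R]_n)
    (x d : 'rV[R]_n) (xS : relative_interior S x) (Sd : S d) :
  \forall t \near (0 : R)^'+, S (x + t *: (x - d)).
Proof.
have [Sx Snear] := xS.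
(* The prolonged point is the affine combination of [x] and [d] with parameter [- t]; for small [t]
   it is also in the neighbourhood of [x] where hull points belong to [S]. *)
have hull t : affine_hull S (x + t *: (x - d)).
  move=> B [Baff SB].
  have -> : x + t *: (x - d) = (1 - (- t)) *: x + (- t) *: d.
    by apply/rowP => i; rewrite !mxE; ring.
  by apply: Baff; exact: SB.
have cv : (fun t : R => x + t *: (x - d)) @ nbhs (0 : R) --> x.
  rewrite -[X in _ --> X]addr0 -(scale0r (x - d)).
  by apply: cvgD; [exact: cvg_cst|apply: cvgZr_tmp; exact: cvg_id].
apply: cvg_within; near=> t.
have : affine_hull S (x + t *: (x - d)) -> S (x + t *: (x - d)).
  by near: t; exact: cv _ Snear.
by apply; exact: hull.
Unshelve. all: by end_near. Qed.

(** Take a matrix of maximal rank among those with rows in [M]: appending a row [z] of [M] cannot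
    raise the rank, so [z] is already in the row space. *)
Lemma spanning_rows {R : realType} {m : nat} (M : set 'rV[R]_m) :
  exists k (A : 'M[R]_(k, m)), (forall i, M (row i A)) /\
    forall z, M z -> (z <= A)%MS.
Proof.
pose P r := `[< exists k (A : 'M[R]_(k, m)), (forall i, M (row i A)) /\
  \rank A = r >].
have P0 : exists r, P r.
  exists 0%N; apply/asboolP; exists 0%N, 0; split; last by rewrite mxrank0.
  by case.
have Pm r : P r -> (r <= m)%N by move=> /asboolP[k [A [_ <-]]]; exact: rank_leq_col.
have [r /asboolP[k [A [MA rA]]] rmax] := ex_maxnP P0 Pm.
exists k, A; split=> // z Mz.
have sub : (A <= col_mx A z)%MS by rewrite -addsmxE addsmxSl.
suff : (col_mx A z <= A)%MS.
  by apply: submx_trans; rewrite -addsmxE addsmxSr.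
rewrite -(geq_leqif (mxrank_leqif_sup sub)) rA; apply: rmax.
apply/asboolP; exists (k + 1)%N, (col_mx A z); split=> // i.
case: (split_ordP i) => j ->; first by rewrite rowKu.
by rewrite rowKd row_id.
Qed.

(* Only the pairings with [M] are controlled, so [w] itself may be unbounded;
   its component along the span of [M] is bounded and has a cluster point. *)
Lemma pairing_cluster {R : realType} {m : nat} (M : set 'rV[R]_m)
    (w : nat -> 'rV[R]_m)
    (Mw : forall z, M z -> exists B : R, \forall j \near \oo, `|dot (w j) z| <= B) :
  exists w0, forall z (h : nat -> R) l, M z -> h j @[j --> \oo] --> l ->
    (\forall j \near \oo, h j <= dot (w j) z) -> l <= dot w0 z.
Proof.
have [k [A [MA spanA]]] := spanning_rows M.
(* [w' j] depends on [w j] only through its pairings with the rows of [A], which are bounded, and it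
   has the same pairings with all of [M]. *)
pose w' j := w j *m A^T *m pinvmx A^T.
have w'P z j : M z -> dot (w' j) z = dot (w j) z.
  move=> /spanA /submxP[c ->]; rewrite !dot_mulmx trmx_mul !mulmxA.
  by rewrite /w' mulmxKpV// submxMl.
have [B BP] : exists B : 'I_k -> R, forall i,
    \forall j \near \oo, `|(w j *m A^T) 0 i| <= B i.
  have /choice [B BP] : forall i, exists B : R,
      \forall j \near \oo, `|(w j *m A^T) 0 i| <= B.
    move=> i; have [B BP] := Mw _ (MA i); exists B.
    apply: filterS BP => j; congr (`|_| <= _).
    by rewrite mxE; apply: eq_bigr => l _; rewrite !mxE.
  by exists B.
pose B' i := \sum_l B l * `|pinvmx A^T l i|.
pose box := [set d : 'rV[R]_m | forall i, `[- B' i, B' i]%classic (d ord0 i)].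
have box_compact : compact box.
  apply: (@rV_compact _ _ (fun i => `[- B' i, B' i]%classic)) => i.
  exact: segment_compact.
have w'box : \forall j \near \oo, box (w' j).
  near=> j.
  have Bj : forall l, `|(w j *m A^T) 0 l| <= B l.
    by near: j; exact: filter_forall.
  move=> i /=.
  rewrite in_itv/= -ler_norml mxE; apply: le_trans (ler_norm_sum _ _ _) _.
  by apply: ler_sum => l _; rewrite normrM ler_wpM2r//.
have [w0 [_ w0cl]] := box_compact (w' @ \oo) _ w'box.
exists w0 => z h l Mz hl hw; rewrite leNgt; apply/negP => lt.
pose c := (dot w0 z + l) / 2.
have [cl cw] : c < l /\ dot w0 z < c by rewrite /c; lra.
have near_lt : nbhs w0 [set x | dot x z < c].
  have cv : (fun x : 'rV[R]_m => dot x z) @ nbhs w0 --> dot w0 z.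
    by apply: cvg_dot; [exact: cvg_id|exact: cvg_cst].
  exact: (cvgr_lt _ cv).
have far : \forall j \near \oo, c < dot (w' j) z.
  have := cvgr_gt _ hl _ cl => hc.
  near=> j; rewrite w'P//.
  have : c < h j by near: j; exact: hc.
  by move/lt_le_trans; apply; near: j.
have [x [/= x1 x2]] := w0cl [set x | c < dot x z] _ far near_lt.
by have := lt_trans x1 x2; rewrite ltxx.
Unshelve. all: by end_near. Qed.

(** * Limits along the sequence: feasibility, stationarity, multipliers *)

Theorem theorem5p7 (R : realType) (n m : nat)
    (C : set 'rV[R]_n) (f : 'rV[R]_n -> R)
    (T : {linear 'rV[R]_n -> 'rV[R]_m}) (D : set 'rV[R]_m)
    (u : nat -> 'rV[R]_n) (alpha : nat -> R) (ubar : 'rV[R]_n)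
    (C_nonempty : C !=set0) (C_compact : compact C) (C_convex : convex_set C)
    (f_C1 : exists U : set 'rV[R]_n,
      [/\ open U, C `<=` U & continuously_differentiable_on U f])
    (f_lip : lipschitz_grad_on C f)
    (D_nonempty : D !=set0) (D_closed : closed D) (D_convex : convex_set D)
    (DTC : D `&` T @` C !=set0)
    (u_in : forall j, C (u j)) (alpha_gt0 : forall j, 0 < alpha j)
    (alpha_cvg : alpha j @[j --> \oo] --> 0)
    (u_cvg : u j @[j --> \oo] --> ubar)
    (gap_cvg : smoothed_gap f T (indicator D) C (alpha j) (u j)
      @[j --> \oo] --> 0%E) :
  let Ct := C `&` T @^-1` D in
  [/\ Ct ubar,
      signed_gap f Ct ubar = 0%E,
      [set grad f ubar + v | v in normal_cone Ct ubar] 0 &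
      relative_interior D `&` relative_interior (T @` C) !=set0 ->
      [set grad f ubar + v + adjoint T w
        | v in normal_cone C ubar & w in normal_cone D (T ubar)] 0].
Proof.
have C_closed : closed C by apply: compact_closed => //; exact: norm_hausdorff.
have Cubar : C ubar.
  by apply: (closed_cvg _ C_closed _ _ u_cvg); near=> j; exact: u_in.
have grad_cvg : grad f (u j) @[j --> \oo] --> grad f ubar.
  have [U [Uo CU [_ fU]]] := f_C1.
  move: fU; rewrite continuous_open_subspace// => fU.
  apply: (cvg_comp u (grad f) u_cvg); apply: fU; rewrite inE; exact: CU.
have /choice[P PP] : forall y, exists p, D p /\
    forall d, D d -> dot (y - p) (d - p) <= 0.
  move=> y.
  by have [p] := projection_exists D D_nonempty D_closed D_convex y; exists p.
(* [P] is the projection onto [D], so [w j] is the gradient of the Moreau envelope at [T (u j)]. *)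
pose r j := T (u j) - P (T (u j)).
pose w j := (alpha j)^-1 *: r j.
pose gam j := fine (smoothed_gap f T (indicator D) C (alpha j) (u j)).
(* Convergence to 0 makes the extended-real gap finite for large [j]; only there is [gam j] known to
   equal it. *)
have [gap_fin gam_cvg] := (fine_cvgP _ _).1 gap_cvg.
have lin_cvg s : dot (grad f (u j)) (u j - s) @[j --> \oo] -->
    dot (grad f ubar) (ubar - s).
  by apply: cvg_dot => //; apply: cvgB => //; exact: cvg_cst.
have gap_le s : C s -> \forall j \near \oo,
    dot (grad f (u j)) (u j - s) + dot (w j) (T (u j) - T s) <= gam j.
  move=> Cs; near=> j.
  have fin : smoothed_gap f T (indicator D) C (alpha j) (u j) \is a fin_num.
    by near: j.
  rewrite -lee_fin /gam fineK//; apply: ereal_sup_ubound; exists s => //.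
  have [DP P_le] := PP (T (u j)).
  rewrite (grad_moreau_indicator D D_nonempty D_closed D_convex _
    (alpha_gt0 j) _ _ DP P_le).
  by rewrite dotDl (dotC (adjoint _ _)) -dot_adjoint linearB (dotC (_ - _)).
have w_proj j d : D d -> dot (w j) (d - P (T (u j))) <= 0.
  by move=> Dd; rewrite dotZl pmulr_rle0 ?invr_gt0//; apply: (PP _).2.
have w_r j : dot (w j) (r j) = (alpha j)^-1 * dot (r j) (r j) by rewrite dotZl.
have w_r0 j : 0 <= dot (w j) (r j).
  by rewrite w_r mulr_ge0 ?dot_ge0// invr_ge0 ltW.
have w_split j d s : dot (w j) (T s - d) = dot (w j) (r j) -
    dot (w j) (d - P (T (u j))) - dot (w j) (T (u j) - T s).
  by rewrite /r !dotE; ring.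
have pair_le s d : C s -> D d -> \forall j \near \oo,
    dot (grad f (u j)) (u j - s) - gam j <= dot (w j) (T s - d).
  move=> Cs Dd; near=> j.
  have : dot (grad f (u j)) (u j - s) + dot (w j) (T (u j) - T s) <= gam j.
    by near: j; exact: gap_le.
  rewrite (w_split j d s); have := w_proj j d Dd; have := w_r0 j; lra.
have pair_cvg s : dot (grad f (u j)) (u j - s) - gam j @[j --> \oo] -->
    dot (grad f ubar) (ubar - s).
  by rewrite -[X in _ --> X]subr0; apply: cvgB.
have DTubar : D (T ubar).
  have [y0 [Ds0 [s0 Cs0 Ts0]]] := DTC; rewrite -Ts0 in Ds0.
  have [Dq q_le] := PP (T ubar); set q := P (T ubar) in Dq q_le.
  suff /dot_eq0/subr0_eq -> : dot (T ubar - q) (T ubar - q) = 0 by [].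
  set e := T ubar - q.
  apply/eqP; rewrite eq_le dot_ge0 andbT.
  (* [b j] bounds |e|^2 for large [j]: the projection inequality at [q] gives |e|^2 <= <T ubar - T
     u_j, e> + <e, r_j>, and 2 <e, r_j> <= |e|^2 + |r_j|^2. Continuity of [P] is thus avoided. *)
  pose b j := 2 * dot (ubar - u j) (adjoint T e) +
    alpha j * (gam j - dot (grad f (u j)) (u j - s0)).
  have b_cvg : b j @[j --> \oo] --> 0.
    have -> : 0 = 2 * dot (ubar - ubar) (adjoint T e) +
        0 * (0 - dot (grad f ubar) (ubar - s0)) :> R.
      by rewrite subrr dot0l !mul0r mulr0 addr0.
    apply: cvgD; last by apply: cvgM => //; apply: cvgB.
    apply: cvgM; first exact: cvg_cst.
    apply: cvg_dot; last exact: cvg_cst.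
    by apply: cvgB => //; exact: cvg_cst.
  apply: (cvgr_to_ge b_cvg); near=> j.
  have gj : dot (grad f (u j)) (u j - s0) - gam j <= dot (w j) (T s0 - T s0).
    by near: j; exact: pair_le.
  have {}gj : dot (grad f (u j)) (u j - s0) + dot (w j) (T (u j) - T s0) <= gam j.
    by near: j; exact: gap_le.
  have rj : dot (r j) (r j) <= alpha j * (gam j - dot (grad f (u j)) (u j - s0)).
    rewrite -ler_pdivrMl// -w_r.
    have := w_proj j _ Ds0; have := w_split j (T s0) s0.
    by rewrite subrr dot0r; lra.
  have qj := q_le _ (PP (T (u j))).1.
  rewrite -/e in qj.
  rewrite /b -dot_adjoint linearB.
  apply: le_trans (lerD (lexx _) rj).
  have sq := dot_ge0 (e - r j).
  have ee : dot e e = dot (T ubar - T (u j)) e + dot e (r j) +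
      dot e (P (T (u j)) - q).
    rewrite (dotC (T ubar - T (u j))) -!dotDr; congr dot.
    by apply/rowP => i; rewrite !mxE; ring.
  rewrite dotBB in sq.
  lra.
have Ct_le s : C s -> D (T s) -> dot (grad f ubar) (ubar - s) <= 0.
  move=> Cs Ds; have := pair_le s _ Cs Ds; rewrite subrr => le0.
  apply: (cvgr_to_le (pair_cvg s)); apply: filterS le0 => j.
  by rewrite dot0r.
have sub_ubar : dot (grad f ubar) (ubar - ubar) = 0.
  by rewrite subrr dot0r.
split.
- by [].
- apply/eqP; rewrite eq_le; apply/andP; split.
    by apply: ge_ereal_sup => _ [s [Cs Ds] <-]; rewrite lee_fin; exact: Ct_le.
  by apply: ereal_sup_ubound; exists ubar => //; rewrite sub_ubar.
- exists (- grad f ubar); last by rewrite subrr.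
  split=> // s [Cs Ds]; rewrite -(opprB ubar) dotNl dotNr opprK; exact: Ct_le.
move=> [z0 [riD riTC]].
pose M : set 'rV[R]_m := [set z | exists s d, [/\ C s, D d & z = T s - d]].
have Mw z : M z -> exists B : R, \forall j \near \oo, `|dot (w j) z| <= B.
  move=> [s [d [Cs Dd ->]]].
  have TCs : (T @` C) (T s) by exists s.
  have nearD := relative_interior_extend _ _ _ riD Dd.
  have nearC := relative_interior_extend _ _ _ riTC TCs.
  (* Prolonging [d] and [T s] beyond [z0] with the same [t] cancels [z0]: the difference of the new
     points is [- t *: (T s - d)]. *)
  have [t [t0 [Dt [s' Cs' Ts']]]] : exists t : R, 0 < t /\
      (D (z0 + t *: (z0 - d)) /\ (T @` C) (z0 + t *: (z0 - T s))).
    apply: (@filter_ex _ (0 : R)^'+); near=> t; split; first by [].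
    by split; near: t.
  pose l := dot (grad f ubar) (ubar - s).
  pose l' := dot (grad f ubar) (ubar - s').
  (* For large [j] the pairing exceeds [l - 1], and by the prolonged pair it stays below
     [(1 - l') / t]; the sum dominates both in absolute value. *)
  exists (`|l - 1| + `|l' - 1| / t); near=> j.
  have lj : l - 1 < dot (w j) (T s - d).
    apply: (@lt_le_trans _ _ (dot (grad f (u j)) (u j - s) - gam j)).
      by near: j; apply: (cvgr_gt _ (pair_cvg s)); rewrite /l; lra.
    by near: j; exact: pair_le.
  have l'j : l' - 1 < dot (w j) (T s' - (z0 + t *: (z0 - d))).
    apply: (@lt_le_trans _ _ (dot (grad f (u j)) (u j - s') - gam j)).
      by near: j; apply: (cvgr_gt _ (pair_cvg s')); rewrite /l'; lra.
    by near: j; exact: pair_le.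
  have : l' - 1 < - (t * dot (w j) (T s - d)).
    by move: l'j; rewrite Ts' !dotE; lra.
  rewrite -ltrNr -ltr_pdivlMl// => {}l'j.
  have n1 := ler_norm (- (l - 1)); rewrite normrN in n1.
  have n2 := ler_norm (- (l' - 1)); rewrite normrN in n2.
  have n3 : t^-1 * - (l' - 1) <= `|l' - 1| / t.
    by rewrite mulrC ler_wpM2r// invr_ge0 ltW.
  have n4 : 0 <= `|l' - 1| / t by rewrite divr_ge0// ltW.
  have n5 := normr_ge0 (l - 1).
  by rewrite ler_norml; apply/andP; split; lra.
have [w0 w0P] := pairing_cluster M w Mw.
have w0_ge s d : C s -> D d -> dot (grad f ubar) (ubar - s) <= dot w0 (T s - d).
  move=> Cs Dd; apply: (w0P _ _ _ _ (pair_cvg s) (pair_le s d Cs Dd)).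
  by exists s, d.
(* Fixing [d = T ubar] in [w0_ge] gives membership in the normal cone of [C]; fixing [s = ubar]
   below gives that of [D]. *)
exists (- grad f ubar - adjoint T w0).
  split=> // s Cs; have := w0_ge s _ Cs DTubar.
  rewrite -linearB (dotC w0) dot_adjoint (dotC (s - ubar)).
  by rewrite -(opprB s) dotNr dotDl !dotNl; lra.
exists w0; last by rewrite addrA subrr sub0r addNr.
split=> // d Dd; have := w0_ge ubar d Cubar Dd.
by rewrite sub_ubar -(opprB d) dotNr oppr_ge0.
Unshelve. all: by end_near. Qed.
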